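(* Let $D=\sum_j a_j\{p_j\}+a\{\infty\}$ be an Arakelov divisor on $\overline{\mathrm{Spec}\,\mathbb{Z}}$. The pointed simplicial set $\mathbf{H}(D)(1_+)$ fulfills the following properties: (i) $\pi_0(\mathbf{H}(D)(1_+))=*$ for $\deg D\ge-\log2$. (ii) For $\deg D<0$, $\#\big(\pi_0(\mathbf{H}(D)(1_+))\big)$ is the largest integer $n<e^{-\deg D}$. (iii) $\pi_1(\mathbf{H}(D)(1_+))$ is in canonical bijection with the global sections $H^0(\overline{\mathrm{Spec}\,\mathbb{Z}},\mathcal{O}(D))=\{x\in L:|x|\le e^a\}$. (iv) $\pi_n(\mathbf{H}(D)(1_+))$ is trivial for $n>1$.
   Context: Arakelov divisors: $D=\sum_j a_j\{p_j\}+a\{\infty\}$ is a finite formal sum, $p_j$ distinct primes, $a_j\in\mathbb{Z}$, $a\in\mathbb{R}$; $\deg D=\sum_j a_j\log p_j+a$. Put $\lambda=e^a$ and $L=\{q\in\mathbb{Q}:|q|_{p_j}\le p_j^{a_j}\ \forall j,\ |q|_p\le1\text{ for all other primes }p\}\subset\mathbb{R}$. $\Delta^{\mathrm{op}}$ is identified with the category of finite intervals $[n]^*=\{0,\dots,n+1\}$ and non-decreasing maps preserving smallest and largest elements; the dual of $\theta\in\mathrm{Hom}_\Delta([n],[m])$ is $\theta^*:[m]^*\to[n]^*$ with $j\le\theta(i)\iff\theta^*(j)\le i$. Let $\phi:\mathbb{R}\to\mathbb{R}/L$ be the quotient map. For a pair of finite pointed sets $*\in Y\subset X$, $K_{L,\lambda}(X,Y)$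 is the set of functions $\psi$ on $X\setminus\{*\}$ with $\psi(x)\in\mathbb{R}$ for $x\in X\setminus Y$, $\psi(y)\in\mathbb{R}/L$ for $y\in Y\setminus\{*\}$, and $\sum_{x\in X\setminus Y}|\psi(x)|\le\lambda$; its base point is $\psi=0$. A pointed map $f:X\to X'$ with $f(Y)\subset Y'$ acts by $\psi\mapsto\psi'$, $\psi'(y)=\sum_{f(x)=y}\psi(x)$ for $y\in X'\setminus Y'$, and $\psi'(y)=\sum_{x\ne *,f(x)=y}p(\psi(x))$ for $y\in Y'\setminus\{*\}$, where $p=\phi$ on $\mathbb{R}$-values and $p=\mathrm{id}$ on $\mathbb{R}/L$-values. The pointed simplicial set $\mathbf{H}(D)(1_+)$ has $n$-simplices $K_{L,\lambda}(X_n,Y_n)$, where $X_n=[n]^*$ pointed by $0$ and $Y_n=\{0,n+1\}$, with simplicial structure given by $\theta\mapsto\theta^*$. Homotopy (the simplicial sets need not be Kan): for a pointed simplicial set $(X,* )$, with $*$ also denoting its degeneracies, $\pi_n(X)$ is the set $\{x\in X_n:\partial_jx=*\ \forall j\}$ of spherical $n$-simplices (all of $X_0$ for $n=0$) together with the relation $\mathcal{R}$ (not an equivalence relation in general): $(x,y)\in\mathcal{R}$ iff there is $z\in X_{n+1}$ with $\partial_jz=*$ for $j<n$, $\partial_nz=x$, $\partial_{n+1}z=y$. When $\mathcal{R}$ is an equivalence relation $\pi_n(X)$ is identified with the quotient set. $\pi_n(X)=*$ (trivial) means that any two spherical $n$-simplices are related by $\mathcal{R}$. For a reflexive relation $\mathcal{R}$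 on a set $E$, $\#(E/\mathcal{R})$ denotes the maximal cardinality of subsets $F\subset E$ such that $x,y\in F$, $x\ne y$ imply $(x,y)\notin\mathcal{R}$; $\#\pi_0(X)$ is $\#(X_0/\mathcal{R})$. In (iii), $1$-simplices are pairs $(\psi_1,\psi_2)\in\mathbb{R}\times\mathbb{R}/L$ (the values of $\psi$ at $1,2\in[1]^*$), and the canonical bijection is induced by $(\psi_1,\psi_2)\mapsto\psi_1$. *)

(* Defs.v *)
From HB Require Import structures.
From mathcomp Require Import all_boot all_order all_algebra.
From mathcomp Require Import finmap.
From mathcomp Require Import all_classical all_reals all_analysis.
From mathcomp Require Import generic_quotient ring_quotient.
From mathcomp Require Import zify.

Set Implicit Arguments.
Unset Strict Implicit.
Unset Printing Implicit Defensive.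

Import Order.TTheory GRing.Theory Num.Theory.

Local Open Scope ring_scope.
Local Open Scope quotient_scope.

Definition padic_abs (p : nat) (q : rat) : rat :=
  if q == 0 then 0
  else p%:R ^ ((logn p `|denq q|%N)%:Z - (logn p `|numq q|%N)%:Z).

(* [adiv_fin D p] is the coefficient of {p}: a finite formal sum of primes is
   a finitely supported function whose support consists of primes. *)
Record arakelovDivisor (R : realType) := ArakelovDivisor {
  adiv_fin : {fsfun nat -> int with 0};
  adiv_inf : R;
  adiv_prime : forall p : nat, p \in finsupp adiv_fin -> prime p
}.

Section ArakelovDivisor.
Variables (R : realType) (D : arakelovDivisor R).

Definition adiv_deg : R :=
  \sum_(p <- finsupp (adiv_fin D)) (adiv_fin D p)%:~R * ln p%:R + adiv_inf D.

(* Outside of the support the bound reads |q|_p <= p ^ 0 = 1. *)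
Definition adiv_lattice : {pred R} := fun x =>
  `[< exists2 q : rat, x = ratr q &
      forall p : nat, prime p -> padic_abs p q <= p%:R ^ (adiv_fin D p) >].

End ArakelovDivisor.

Lemma padic_absE p (a b : int) : prime p -> a != 0 -> b != 0 ->
  padic_abs p (a%:~R / b%:~R) = p%:R ^ ((logn p `|b|%N)%:Z - (logn p `|a|%N)%:Z).
Proof.
move=> pp a0 b0; set q := _ / _.
have q0 : q != 0 by rewrite mulf_neq0 ?invr_eq0 ?intr_eq0.
rewrite /padic_abs (negPf q0); congr (_ ^ _).
have nq0 : numq q != 0 by rewrite numq_eq0.
have E : numq q * b = a * denq q.
  apply: (@intr_inj rat); rewrite !rmorphM /=.
  have db0 : (denq q)%:~R != 0 :> rat by rewrite intr_eq0 denq_neq0.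
  have bb0 : b%:~R != 0 :> rat by rewrite intr_eq0.
  by rewrite numqE /q mulrAC divfK.
have : logn p (`|numq q|%N * `|b|%N) = logn p (`|a|%N * `|denq q|%N).
  by rewrite -!abszM E.
rewrite !lognM ?absz_gt0 ?denq_neq0 // => EE.
lia.
Qed.

Lemma padic_absN p q : padic_abs p (- q) = padic_abs p q.
Proof. by rewrite /padic_abs oppr_eq0 denqN numqN abszN. Qed.

Lemma logn_addz p (a b : int) : prime p -> a != 0 -> b != 0 -> a + b != 0 ->
  (minn (logn p `|a|%N) (logn p `|b|%N) <= logn p `|(a + b)%R|%N)%N.
Proof.
move=> pp a0 b0 ab0.
rewrite -pfactor_dvdn ?absz_gt0 //.
set k := minn _ _.
have -> : (p ^ k %| `|(a + b)%R|%N)%N = (Posz (p ^ k) %| a + b)%Z by [].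
apply: rpredD.
  have -> : (a \in dvdz (p ^ k)%N) = (p ^ k %| `|a|%N)%N by [].
  by rewrite pfactor_dvdn ?absz_gt0 // geq_minl.
have -> : (b \in dvdz (p ^ k)%N) = (p ^ k %| `|b|%N)%N by [].
by rewrite pfactor_dvdn ?absz_gt0 // geq_minr.
Qed.

Lemma padic_absD_le p q r (c : rat) : prime p -> 0 <= c ->
  padic_abs p q <= c -> padic_abs p r <= c -> padic_abs p (q + r) <= c.
Proof.
move=> pp c0.
have [->|q0] := eqVneq q 0; first by rewrite add0r.
have [->|r0] := eqVneq r 0; first by rewrite addr0.
have [->|s0] := eqVneq (q + r) 0; first by rewrite /padic_abs eqxx.
have dq : denq q != 0 by rewrite denq_neq0.
have dr : denq r != 0 by rewrite denq_neq0.
have nq : numq q != 0 by rewrite numq_eq0.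
have nr : numq r != 0 by rewrite numq_eq0.
have dq' : (denq q)%:~R != 0 :> rat by rewrite intr_eq0.
have dr' : (denq r)%:~R != 0 :> rat by rewrite intr_eq0.
have Eq : q = (numq q * denq r)%:~R / (denq q * denq r)%:~R.
  by rewrite !intrM -mulf_div divff // mulr1 divq_num_den.
have Er : r = (numq r * denq q)%:~R / (denq q * denq r)%:~R.
  by rewrite !intrM [(denq q)%:~R * _]mulrC -mulf_div divff // mulr1 divq_num_den.
set A := numq q * denq r in Eq.
set B := numq r * denq q in Er.
set C := denq q * denq r in Eq Er.
have A0 : A != 0 by rewrite mulf_neq0.
have B0 : B != 0 by rewrite mulf_neq0.
have C0 : C != 0 by rewrite mulf_neq0.
have Es : q + r = (A + B)%:~R / C%:~R by rewrite {1}Eq {1}Er -mulrDl -intrD.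
have AB0 : A + B != 0.
  by apply: contra_neq s0 => AB; rewrite Es AB mul0r.
rewrite Es {1}Eq {1}Er !padic_absE //.
have := logn_addz pp A0 B0 AB0.
have p1 : (1 : rat) <= p%:R by rewrite ler1n prime_gt0.
have mono (i j : int) : (i <= j)%R -> (p%:R : rat) ^ i <= p%:R ^ j.
  by move=> ij; rewrite ler_weXz2l.
rewrite geq_min => /orP[] h H1 H2.
  by apply: le_trans H1; apply: mono; rewrite lerD2l lerN2 lez_nat.
by apply: le_trans H2; apply: mono; rewrite lerD2l lerN2 lez_nat.
Qed.

Lemma adiv_lattice_zmod_closed (R : realType) (D : arakelovDivisor R) :
  zmod_closed (adiv_lattice D).
Proof.
split.
  apply/asboolP; exists 0; first by rewrite rmorph0.
  by move=> p pp; rewrite /padic_abs eqxx exprz_ge0 // ler0n.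
move=> _ _ /asboolP[q -> hq] /asboolP[r -> hr]; apply/asboolP.
exists (q - r); first by rewrite rmorphB.
move=> p pp; apply: padic_absD_le => //; rewrite ?padic_absN; auto.
by rewrite exprz_ge0 // ler0n.
Qed.

HB.instance Definition _ (R : realType) (D : arakelovDivisor R) :=
  GRing.isZmodClosed.Build R (adiv_lattice D) (adiv_lattice_zmod_closed D).

Definition adiv_H0 (R : realType) (D : arakelovDivisor R) : set R :=
  [set x | x \in adiv_lattice D /\ `|x| <= expR (adiv_inf D)]%classic.

Record deltaHom (m n : nat) := DeltaHom {
  delta_fun :> 'I_m.+1 -> 'I_n.+1;
  delta_homo : {homo delta_fun : i j / (i <= j)%N}
}.

Definition delta_id n : deltaHom n n :=
  @DeltaHom n n id (fun _ _ le_ij => le_ij).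

Definition delta_comp m n p (t : deltaHom n p) (s : deltaHom m n) :
    deltaHom m p :=
  @DeltaHom m p (t \o s) (fun _ _ le_ij => delta_homo t (delta_homo s le_ij)).

Lemma lift_homo n (j : 'I_n.+2) : {homo (lift j : 'I_n.+1 -> 'I_n.+2) :
  i k / (i <= k)%N}.
Proof. by move=> i k; rewrite /= leq_bump2. Qed.

Definition coface n (j : 'I_n.+2) : deltaHom n n.+1 := DeltaHom (@lift_homo n j).

Record pointedSSet := PointedSSet {
  simplex :> nat -> Type;
  sact : forall m n, deltaHom m n -> simplex n -> simplex m;
  sbase : forall n, simplex n;
  sact_id : forall n (x : simplex n), sact (delta_id n) x = x;
  sact_comp : forall m n p (t : deltaHom n p) (s : deltaHom m n) x,
    sact (delta_comp t s) x = sact s (sact t x);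
  sact_base : forall m n (t : deltaHom m n), sact t (sbase n) = sbase m
}.

Section Homotopy.
Variable X : pointedSSet.

Definition face n (j : 'I_n.+2) : X n.+1 -> X n := sact (coface j).

Definition spherical n : X n -> Prop :=
  match n with
  | 0 => fun=> True
  | m.+1 => fun x => forall j : 'I_m.+2, face j x = sbase X m
  end.

Definition pi_set n : Type := {x : X n | spherical x}.

(* In 'I_n.+2 the index n is [inord n] and the index n+1 is [ord_max]. *)
Definition htpy n (x y : pi_set n) : Prop :=
  exists z : X n.+1,
    [/\ forall j : 'I_n.+2, (j < n)%N -> face j z = sbase X n,
        face (inord n) z = sval x & face ord_max z = sval y].

Definition pi_trivial n := forall x y : pi_set n, htpy x y.

End Homotopy.

Local Open Scope classical_set_scope.
Local Open Scope card_scope.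

Definition unrelated (E : Type) (r : E -> E -> Prop) (F : set E) :=
  forall x y, F x -> F y -> x <> y -> ~ r x y.

(* #(E/r), the maximal cardinality of a set of pairwise unrelated elements, is
   finite and equal to k. *)
Definition nb_classes (E : Type) (r : E -> E -> Prop) (k : nat) :=
  (exists2 F : set E, unrelated r F & F #= `I_k) /\
  (forall F : set E, unrelated r F -> F #<= `I_k).

Definition quotient_set (E : Type) (r : E -> E -> Prop) : set (set E) :=
  range (fun x => [set y | r x y]).

Local Close Scope card_scope.
Local Close Scope classical_set_scope.

Record finPair := FinPair {
  fp_sort :> finType;
  fp_pt : fp_sort;
  fp_sub : {set fp_sort};
  fp_pt_sub : fp_pt \in fp_sub
}.

Record finPairHom (P Q : finPair) := FinPairHom {
  fph_fun :> P -> Q;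
  fph_pt : fph_fun (fp_pt P) = fp_pt Q;
  fph_sub : forall x, x \in fp_sub P -> fph_fun x \in fp_sub Q
}.

Definition fp_out (P : finPair) := {x : P | x \notin fp_sub P}.
Definition fp_in (P : finPair) :=
  {y : P | (y \in fp_sub P) && (y != fp_pt P)}.


Section KFunctor.
Variables (R : realType) (L : zmodClosed R) (lam : R).

Local Notation RL := (Quotient.quot L).

(* For P = (X, Y): an element psi is split into its real values on X \ Y and
   its R/L-values on Y \ {*}. *)
Record Kset (P : finPair) := KElt {
  kreal : {ffun fp_out P -> R};
  kquot : {ffun fp_in P -> RL};
  kbound : \sum_x `|kreal x| <= lam
}.

Lemma K_ext P (u v : Kset P) : kreal u = kreal v -> kquot u = kquot v -> u = v.
Proof.
case: u v => [a b c] [a' b' c'] /= E1 E2; move: c c'; rewrite E1 E2 => c c'.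
by congr KElt; exact: bool_irrelevance.
Qed.

Definition kmap_real P Q (f : finPairHom P Q) (u : Kset P) : {ffun fp_out Q -> R} :=
  [ffun y => \sum_(x : fp_out P | f (val x) == val y) kreal u x].

Definition kmap_quot P Q (f : finPairHom P Q) (u : Kset P) :
    {ffun fp_in Q -> RL} :=
  [ffun y => \sum_(x : fp_out P | f (val x) == val y) \pi_RL (kreal u x)
           + \sum_(x : fp_in P | f (val x) == val y) kquot u x].

Lemma sum_fiber (I T : finType) (A : pred T) (V : nmodType) (h : I -> T)
    (c : pred T) (F : I -> V) :
  \sum_(y : {y : T | A y} | c (val y)) \sum_(i | h i == val y) F i
  = \sum_(i | A (h i) && c (h i)) F i.
Proof.
rewrite (exchange_big_dep xpredT) //= [RHS]big_mkcond /=; apply: eq_bigr => i _.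
have [Ah|nAh] /= := boolP (A (h i)); last first.
  rewrite big_pred0 // => y; apply/negP => /andP[_ /eqP E].
  by move: nAh; rewrite E (valP y).
have [ch|nch] := boolP (c (h i)); last first.
  rewrite big_pred0 // => y; apply/negP => /andP[cy /eqP E].
  by move: nch; rewrite E cy.
rewrite (big_pred1 (Sub (h i) Ah)) // => y /=.
rewrite -val_eqE /= [RHS]eq_sym; apply/andb_idl => /eqP <- //.
Qed.

Lemma kmap_bound P Q (f : finPairHom P Q) (u : Kset P) :
  \sum_y `|kmap_real f u y| <= lam.
Proof.
apply: le_trans (kbound u).
apply: (@le_trans _ _ (\sum_(y : fp_out Q)
    \sum_(x : fp_out P | f (val x) == val y) `|kreal u x|)).
  by apply: ler_sum => y _; rewrite ffunE; exact: ler_norm_sum.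
rewrite (sum_fiber (fun y => y \notin fp_sub Q) (fun x => f (val x)) xpredT).
rewrite [leRHS](bigID (fun x => f (val x) \notin fp_sub Q)) /=.
under eq_bigl do rewrite andbT.
by rewrite lerDl sumr_ge0.
Qed.

Definition kmap P Q (f : finPairHom P Q) (u : Kset P) : Kset Q :=
  KElt (kmap_quot f u) (kmap_bound f u).

Lemma kmap_id P (f : finPairHom P P) (u : Kset P) : f =1 id -> kmap f u = u.
Proof.
move=> fE; apply: K_ext; apply/ffunP => y; rewrite !ffunE.
  by rewrite (big_pred1 y) // => x /=; rewrite fE val_eqE.
rewrite big_pred0 ?add0r => [|x]; last first.
  rewrite fE; apply/negP => /eqP E; have := valP x.
  by rewrite /= E; have /andP[-> _] := valP y.
by rewrite (big_pred1 y) // => x /=; rewrite fE val_eqE.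
Qed.

Lemma kmap_comp P Q S (g : finPairHom Q S) (f : finPairHom P Q)
    (h : finPairHom P S) (u : Kset P) : h =1 g \o f ->
  kmap h u = kmap g (kmap f u).
Proof.
move=> hE; apply: K_ext; apply/ffunP => z; rewrite !ffunE.
  under [RHS]eq_bigr do rewrite ffunE.
  rewrite (sum_fiber (fun y => y \notin fp_sub Q) (fun x => f (val x))
    (fun y => g y == val z)).
  apply: eq_bigl => x; rewrite hE /=; apply/esym/andb_idl => /eqP E.
  apply: contra (valP z); rewrite /= -E; exact: fph_sub.
under [X in _ = X + _]eq_bigr do rewrite ffunE raddf_sum.
under [X in _ = _ + X]eq_bigr do rewrite ffunE.
rewrite big_split /= addrA.
rewrite (sum_fiber (fun y => y \notin fp_sub Q) (fun x : fp_out P => f (val x))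
    (fun y => g y == val z)).
rewrite (sum_fiber (fun y => (y \in fp_sub Q) && (y != fp_pt Q))
    (fun x : fp_out P => f (val x)) (fun y => g y == val z)).
rewrite (sum_fiber (fun y => (y \in fp_sub Q) && (y != fp_pt Q))
    (fun x : fp_in P => f (val x)) (fun y => g y == val z)).
have zpt : val z != fp_pt S by have /andP[] := valP z.
have ptE y : g y == val z -> y != fp_pt Q.
  by move=> /eqP gy; apply: contra zpt => /eqP yE; rewrite -gy yE fph_pt.
congr (_ + _); last first.
  apply: eq_bigl => x; rewrite hE /=; apply/esym/andb_idl => gfx.
  by rewrite ptE // fph_sub //; have /andP[] := valP x.
rewrite (bigID (fun x => f (val x) \notin fp_sub Q)) /=.
congr (_ + _); apply: eq_bigl => x; rewrite hE /=; first by rewrite andbC.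
by rewrite negbK andbC; case: (boolP (g _ == _)) => [/ptE ->|]; rewrite ?andbF ?andbT.
Qed.

Hypothesis lam_ge0 : 0 <= lam.

Lemma kbase_bound P : \sum_x `|([ffun=> 0] : {ffun fp_out P -> R}) x| <= lam.
Proof. by rewrite big1 // => x _; rewrite ffunE normr0. Qed.

Definition kbase P : Kset P := KElt [ffun=> 0] (kbase_bound P).

Lemma kmap_base P Q (f : finPairHom P Q) : kmap f (kbase P) = kbase Q.
Proof.
apply: K_ext; apply/ffunP => y; rewrite !ffunE.
  by rewrite big1 // => x _; rewrite ffunE.
by rewrite !big1 ?addr0 // => x _; rewrite ffunE // raddf0.
Qed.

End KFunctor.

Lemma interval_pt n : ord0 \in [set ord0; ord_max : 'I_n.+2].
Proof. by rewrite !inE eqxx. Qed.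

Definition interval n : finPair := FinPair (interval_pt n).

(* The least i such that j <= t i, or n+1 if there is none; see [dualE]. *)
Definition dual_fun n m (t : deltaHom n m) (j : interval m) : interval n :=
  inord (find (fun i => j <= t i)%N (enum 'I_n.+1)).

Lemma dual_fun_val n m (t : deltaHom n m) (j : interval m) :
  dual_fun t j = find (fun i => j <= t i)%N (enum 'I_n.+1) :> nat.
Proof.
by rewrite inordK // ltnS -[leqRHS](size_enum_ord n.+1) find_size.
Qed.

Lemma dualE n m (t : deltaHom n m) (j : interval m) (i : 'I_n.+1) :
  (j <= t i)%N = (dual_fun t j <= i)%N.
Proof.
rewrite dual_fun_val; set a := fun i => _; set s := enum _.
have nthE (k : 'I_n.+1) : nth ord0 s k = k by rewrite nth_ord_enum.
apply/idP/idP => [ji|fi].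
  by rewrite leqNgt; apply/negP => /(before_find ord0); rewrite nthE /a ji.
have fs : (find a s < n.+1)%N by apply: leq_ltn_trans fi _.
have ha : has a s by rewrite has_find size_enum_ord.
have := nth_find ord0 ha; rewrite (nthE (Ordinal fs)) /a => /leq_trans; apply.
exact: delta_homo.
Qed.

Lemma interval_eq n (u v : interval n) :
  (forall i : 'I_n.+1, (u <= i)%N = (v <= i)%N) -> u = v.
Proof.
move=> H; apply/val_inj/eqP => /=; rewrite eqn_leq.
have lt (w : interval n) : (w <= n.+1)%N by rewrite -ltnS; exact: (ltn_ord w).
apply/andP; split.
  have [vn|] := ltnP v n.+1; first by rewrite (H (Ordinal vn)).
  exact: leq_trans.
have [vn|] := ltnP u n.+1; first by rewrite -(H (Ordinal vn)).
exact: leq_trans.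
Qed.

Lemma dual_fun0 n m (t : deltaHom n m) : dual_fun t ord0 = ord0.
Proof. by apply: interval_eq => i; rewrite -dualE. Qed.

Lemma dual_fun_max n m (t : deltaHom n m) : dual_fun t ord_max = ord_max.
Proof. by apply: interval_eq => i; rewrite -dualE /= leqNgt ltn_ord leqNgt ltn_ord. Qed.

Lemma dual_fun_sub n m (t : deltaHom n m) (x : interval m) :
  x \in fp_sub (interval m) -> dual_fun t x \in fp_sub (interval n).
Proof.
by rewrite !inE => /orP[] /eqP ->; rewrite ?dual_fun0 ?dual_fun_max eqxx ?orbT.
Qed.

Definition dual_hom n m (t : deltaHom n m) : finPairHom (interval m) (interval n) :=
  FinPairHom (dual_fun0 t) (@dual_fun_sub n m t).

Lemma dual_id n : dual_hom (delta_id n) =1 id.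
Proof. by move=> j; apply: interval_eq => i /=; rewrite -dualE. Qed.

Lemma dual_comp m n p (t : deltaHom n p) (s : deltaHom m n) :
  dual_hom (delta_comp t s) =1 dual_hom s \o dual_hom t.
Proof. by move=> j; apply: interval_eq => i /=; rewrite -!dualE. Qed.

Section HD.
Variables (R : realType) (D : arakelovDivisor R).

Let L : zmodClosed R := adiv_lattice D.
Let lam : R := expR (adiv_inf D).

Definition HD : pointedSSet := @PointedSSet
  (fun n => Kset L lam (interval n))
  (fun m n t => kmap (dual_hom t))
  (fun n => kbase L (expR_ge0 (adiv_inf D)) (interval n))
  (fun n x => kmap_id x (@dual_id n))
  (fun m n p t s x => kmap_comp x (dual_comp t s))
  (fun m n t => kmap_base L (expR_ge0 (adiv_inf D)) (dual_hom t)).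

Lemma interval1_out : (inord 1 : interval 1) \notin fp_sub (interval 1).
Proof. by rewrite !inE -!val_eqE /= inordK. Qed.

(* The value psi_1 at 1 of a 1-simplex (psi_1, psi_2). *)
Definition HD_psi1 (psi : HD 1%N) : R := kreal psi (Sub (inord 1) interval1_out).

End HD.

(* Main.v *)
From mathcomp Require Import all_boot all_order all_algebra.
From mathcomp Require Import finmap.
From mathcomp Require Import all_classical all_reals all_analysis.
From mathcomp Require Import generic_quotient ring_quotient.
From mathcomp Require Import zify ring lra.
Require Import Defs.

(** The lattice [L] is generated by the rational number
    [\prod_p p ^ (- a_p)], so that [R / L] is a circle whose circumference
    [period D] is [expR (- deg D) * lam], where [lam = expR a]
    ([latticeP], [period_ratio]).  Everything else is read off the faces.
    An n-simplex is a tuple [(psi_1, ..., psi_n, psi_{n+1})] of [n] real numbers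
    whose absolute values add up to at most [lam], followed by a point of the
    circle; the j-th face adds up the adjacent entries [psi_j] and [psi_{j+1}],
    where [psi_0] is discarded and the last sum is taken in the circle
    ([rcoord_face], [qcoord_face]).

    In degree 0 this says that two points of the circle are related when one is
    obtained from the other by a translation of length at most [lam]
    ([htpy0E]).  All points are related as soon as [lam] is at least half
    the circumference, which is (i).  When [lam] is less than the circumference,
    pairwise unrelated points are points at mutual distance [> lam].  There are
    [n] of them if [n * lam] is less than the circumference, namely [n] equally
    spaced points ([unrelated_packing]); there are no more than [n] if the
    circumference is at most [n.+1 * lam], because when the circle is cut into
    arcs of length [lam], from one of the given points on, each arc contains at
    most one of them and the last stretch of length [lam], which leads back to
    the starting point, contains none ([unrelated_card_le]).
    Hence (ii).

    In degree 1 the spherical simplices are the pairs [(x, 0)] with [x] in [L]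
    and [`|x| <= lam] ([spherical1P]).  A 2-simplex whose 0-th face is the base
    point is of the form [(x, 0, 0)], and its other two faces are equal: the
    homotopy relation is the equality ([htpy1E]), which gives (iii).  In degree
    [n >= 2], the 0-th face forces all entries but [psi_1] to vanish, and the
    next one, which contains [psi_1 + psi_2] as a real entry, forces
    [psi_1 = 0]: the base point is the only spherical simplex
    ([spherical_base]), which gives (iv). *)

Set Implicit Arguments.
Unset Strict Implicit.
Unset Printing Implicit Defensive.

Import Order.TTheory GRing.Theory Num.Theory.
Local Open Scope classical_set_scope.
Local Open Scope ring_scope.
Local Open Scope quotient_scope.

(** * The lattice of an Arakelov divisor *)

Lemma padic_abs_gt0 p q : prime p -> q != 0 -> 0 < padic_abs p q.
Proof.
by move=> pp q0; rewrite /padic_abs (negPf q0) exprz_gt0 // ltr0n prime_gt0.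
Qed.

Lemma padic_abs1 p : padic_abs p 1 = 1.
Proof. by rewrite /padic_abs oner_eq0 logn1 subrr expr0z. Qed.

Lemma padic_absM p q r : prime p ->
  padic_abs p (q * r) = padic_abs p q * padic_abs p r.
Proof.
move=> pp; have [->|q0] := eqVneq q 0; first by rewrite /padic_abs !mul0r.
have [->|r0] := eqVneq r 0; first by rewrite /padic_abs !(mulr0, eqxx).
have nz (s : rat) : s != 0 -> numq s != 0 by rewrite numq_eq0.
have -> : q * r = (numq q * numq r)%:~R / (denq q * denq r)%:~R.
  by rewrite !intrM -mulf_div !divq_num_den.
rewrite padic_absE ?mulf_neq0 ?nz ?denq_neq0 //.
rewrite !abszM !lognM ?absz_gt0 ?nz ?denq_neq0 //.
rewrite /padic_abs (negPf q0) (negPf r0) -expfzDr ?pnatr_eq0 -?lt0n ?prime_gt0 //.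
by congr (_ ^ _); lia.
Qed.

Lemma padic_absV p q : prime p -> q != 0 -> padic_abs p q^-1 = (padic_abs p q)^-1.
Proof.
move=> pp q0; apply: (mulfI (lt0r_neq0 (padic_abs_gt0 pp q0))).
by rewrite -padic_absM // !divff ?padic_abs1 // gt_eqF ?padic_abs_gt0.
Qed.

Lemma padic_abs_prime p r : prime p -> prime r ->
  padic_abs p r%:R = if p == r then p%:R^-1 else 1.
Proof.
move=> pp pr; have r0 : r%:Z != 0 by rewrite -lt0n prime_gt0.
have -> : r%:R = r%:~R / 1%:~R :> rat by rewrite divr1 -pmulrn.
rewrite padic_absE // logn1 /= logn_prime // eq_sym.
by case: eqP => _; rewrite ?subrr ?expr0z // sub0r expN1r -?exprN1 ?expr1z.
Qed.

Lemma padic_abs_primeX p r (k : int) : prime p -> prime r ->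
  padic_abs p (r%:R ^ k) = if p == r then p%:R ^ (- k) else 1.
Proof.
move=> pp pr; have r0 : r%:R != 0 :> rat by rewrite pnatr_eq0 -lt0n prime_gt0.
have Xn (n : nat) : padic_abs p (r%:R ^+ n) = padic_abs p r%:R ^+ n.
  by elim: n => [|n IH]; rewrite ?expr0 ?padic_abs1 // !exprS padic_absM // IH.
case: k => n.
  rewrite -exprnP Xn padic_abs_prime //.
  by case: eqP => _; rewrite ?expr1n // exprVn -exprnN.
rewrite NegzE -exprnN opprK padic_absV ?expf_neq0 // Xn padic_abs_prime //.
by case: eqP => _; rewrite ?expr1n ?invr1 // exprVn invrK.
Qed.

Lemma padic_abs_prod p (I : eqType) (s : seq I) (F : I -> rat) : prime p ->
  padic_abs p (\prod_(i <- s) F i) = \prod_(i <- s) padic_abs p (F i).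
Proof.
move=> pp; elim: s => [|i s IH]; first by rewrite !big_nil padic_abs1.
by rewrite !big_cons padic_absM // IH.
Qed.

(** If a prime [p] divided the denominator it would not divide the numerator,
    and the p-adic absolute value would be at least [p]. *)
Lemma padic_abs_int q : (forall p, prime p -> padic_abs p q <= 1) <-> q \is a Num.int.
Proof.
split=> [H|/intrP[m ->] p pp]; last first.
  have [->|m0] := eqVneq m 0; first by rewrite /padic_abs eqxx.
  have -> : m%:~R = m%:~R / 1%:~R :> rat by rewrite divr1.
  rewrite padic_absE // logn1 sub0r.
  by rewrite -(expr0z p%:R) ler_weXz2l ?ler1n ?prime_gt0 // oppr_le0.
rewrite Qint_def; have d0 := denq_gt0 q.
have [|dgt1] := leqP `|denq q|%N 1; first by lia.
pose p := pdiv `|denq q|.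
have pp : prime p by rewrite pdiv_prime.
have pd : (p %| `|denq q|)%N by rewrite pdiv_dvd.
have := H p pp; rewrite leNgt => /negP[].
have q0 : q != 0 by apply: contraTneq dgt1 => ->.
rewrite /padic_abs (negPf q0).
have -> : logn p `|numq q|%N = 0%N.
  apply/eqP; rewrite -leqn0 leqNgt logn_gt0 mem_primes pp /=.
  apply/negP => /andP[_ pn].
  have := coprime_num_den q; rewrite /coprime => /eqP g1.
  have : (p %| gcdn `|numq q| `|denq q|)%N by rewrite dvdn_gcd pn pd.
  by rewrite g1 dvdn1 => /eqP p1; rewrite p1 in pp.
rewrite subr0 -exprnP exprn_egt1 ?ltr1n ?prime_gt1 // -lt0n logn_gt0.
by rewrite mem_primes pp absz_gt0 denq_neq0.
Qed.

Section Lattice.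
Variables (R : realType) (D : arakelovDivisor R).

(** With the exponent [- a_p], the p-adic absolute value of the generator is
    the largest one that the lattice allows. *)
Definition lattice_gen : rat :=
  \prod_(p <- finsupp (adiv_fin D)) p%:R ^ (- adiv_fin D p).

Lemma lattice_gen_neq0 : lattice_gen != 0.
Proof.
rewrite /lattice_gen big_seq prodf_seq_neq0; apply/allP => p /adiv_prime pp.
by rewrite implybE expfz_neq0 ?orbT // pnatr_eq0 -lt0n prime_gt0.
Qed.

Lemma padic_abs_lattice_gen p : prime p ->
  padic_abs p lattice_gen = p%:R ^ adiv_fin D p.
Proof.
move=> pp; rewrite padic_abs_prod //.
have E r : r \in finsupp (adiv_fin D) -> padic_abs p (r%:R ^ (- adiv_fin D r)) =
    if r == p then p%:R ^ adiv_fin D p else 1.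
  by move=> /adiv_prime pr; rewrite padic_abs_primeX // opprK eq_sym; case: eqP => // ->.
rewrite (eq_big_seq _ E) -big_mkcond /=.
have [pD|pD] := boolP (p \in finsupp (adiv_fin D)).
  rewrite big_mkcond (bigD1_seq p) ?fset_uniq //= eqxx big1 ?mulr1 // => r.
  by move=> /negPf ->.
by rewrite (fsfun_dflt pD) big_mkcond big1 // => r _; case: ifP.
Qed.

(** The circumference of [R / L], in terms of the degree; [periodE] identifies
    it with the generator of [L]. *)
Definition period : R := expR (adiv_inf D - adiv_deg D).

Lemma periodE : period = ratr lattice_gen.
Proof.
rewrite /period /adiv_deg opprD addrCA subrr addr0 -sumrN expR_sum.
rewrite /lattice_gen rmorph_prod; apply: eq_big_seq => p /adiv_prime pp.
have p0 : 0 < p%:R :> R by rewrite ltr0n prime_gt0.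
rewrite fmorphXz rmorph_nat -mulNr -rmorphN /=.
by rewrite -powR_intmul ?ler0n // /powR gt_eqF.
Qed.

(** Dividing by the generator turns the conditions that define [L] into
    p-integrality at every prime. *)
Lemma latticeP (x : R) :
  reflect (exists m : int, x = m%:~R * period) (x \in adiv_lattice D).
Proof.
have g0 := lattice_gen_neq0.
have quot_le1 (q : rat) p : prime p ->
    (padic_abs p (q / lattice_gen) <= 1) = (padic_abs p q <= p%:R ^ adiv_fin D p).
  move=> pp; rewrite padic_absM // padic_absV // padic_abs_lattice_gen //.
  by rewrite ler_pdivrMr ?mul1r // exprz_gt0 // ltr0n prime_gt0.
have boundP (q : rat) : (forall p, prime p -> padic_abs p q <= p%:R ^ adiv_fin D p) <->
    q / lattice_gen \is a Num.int.
  by rewrite -padic_abs_int; split=> H p pp; move: (H p pp); rewrite quot_le1.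
apply: (iffP (asboolP _)) => [[q -> /boundP/intrP[m E]]|[m ->]].
  exists m; rewrite periodE -(ratr_int R) -rmorphM /= -E divfK //.
exists (m%:~R * lattice_gen); first by rewrite rmorphM /= ratr_int periodE.
by apply/boundP; rewrite mulfK.
Qed.

End Lattice.

(** * Coordinates of simplices and their faces *)

Lemma dual_coface n (j : 'I_n.+2) (x : interval n.+1) :
  dual_fun (coface j) x = (if (x <= j)%N then x : nat else x.-1) :> nat.
Proof.
set k := (if _ then _ else _).
have kn : (k < n.+2)%N.
  have jn := ltn_ord j; have xn : (x < n.+3)%N := ltn_ord x.
  rewrite /k; case: (leqP x j); lia.
suff -> : dual_fun (coface j) x = Ordinal kn by [].
apply: interval_eq => i; rewrite -dualE /= /bump /k.
by case: (leqP x j); case: (leqP j i) => /=; lia.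
Qed.

Section Coordinates.
Variables (R : realType) (L : zmodClosed R) (lam : R).
Local Notation RL := (Quotient.quot L).
Local Notation K n := (Kset L lam (interval n)).

(** Extending the real entries by 0 to all natural numbers turns the sums over
    [fp_out] that define faces into sums over an ordinal ([sum_fp_out]). *)
Definition rcoord n (u : K n) (k : nat) : R :=
  if insub (inord k : interval n) is Some x then kreal u x else 0.

Lemma interval_top n : (ord_max \in fp_sub (interval n)) && (ord_max != fp_pt (interval n)).
Proof. by rewrite !inE eqxx orbT. Qed.

Definition itop n : fp_in (interval n) := Sub ord_max (interval_top n).

(** [fp_in (interval n)] is a singleton ([fp_in_top]): a simplex has a
    single entry in [R / L]. *)
Definition qcoord n (u : K n) : RL := kquot u (itop n).

Lemma fp_in_top n (y : fp_in (interval n)) : y = itop n.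
Proof.
apply/val_inj; have /andP[] := valP y.
by rewrite !inE => /orP[/eqP -> /eqP|/eqP ->].
Qed.

Lemma fp_outP n (x : interval n) : (x \notin fp_sub (interval n)) = (0 < x <= n)%N.
Proof. by have := ltn_ord x; rewrite !inE -!val_eqE /=; lia. Qed.

Lemma rcoordE n (u : K n) (x : fp_out (interval n)) : kreal u x = rcoord u (val x).
Proof. by rewrite /rcoord inord_val valK. Qed.

Lemma rcoord_out n (u : K n) k : ~~ (0 < k <= n)%N -> rcoord u k = 0.
Proof.
move=> nk; rewrite /rcoord insubF //; apply: contraNF nk; rewrite fp_outP.
have [kn|kn] := ltnP k n.+2; first by rewrite inordK.
suff -> : inord k = ord0 :> 'I_n.+2 by [].
by apply: val_inj; rewrite val_insubd ltnNge kn.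
Qed.

Lemma K_eqP n (u v : K n) :
  (forall k, (0 < k <= n)%N -> rcoord u k = rcoord v k) -> qcoord u = qcoord v -> u = v.
Proof.
move=> h1 h2; apply: K_ext; apply/ffunP => x.
  by rewrite !rcoordE h1 // -fp_outP (valP x).
by rewrite (fp_in_top x).
Qed.

Lemma sum_fp_out n (P : pred nat) (u : K n) (V : nmodType) (f : R -> V) : f 0 = 0 ->
  \sum_(x : fp_out (interval n) | P (val x)) f (kreal u x) =
  \sum_(i < n.+2 | P i) f (rcoord u i).
Proof.
move=> f0; under eq_bigr do rewrite rcoordE.
rewrite -(big_sub_cond (fun x => x \notin fp_sub (interval n)) (fun x : interval n => P x)
   (fun x => f (rcoord u x))).
rewrite big_mkcondl /=; apply: eq_bigr => i _.
rewrite unfold_in fp_outP.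
by case: ifPn => // /rcoord_out ->; rewrite f0.
Qed.

Lemma rcoord_le n (u : K n) k : `|rcoord u k| <= lam.
Proof.
have le_sum := kbound u; rewrite /rcoord; case: insubP => [x _ _|_].
  by apply: le_trans le_sum; rewrite (bigD1 x) //= lerDl sumr_ge0.
by rewrite normr0; apply: le_trans le_sum; rewrite sumr_ge0.
Qed.

(** Both summands are present exactly when [k = j], the position where two
    adjacent entries are merged. *)
Lemma rcoord_face n (j : 'I_n.+2) (u : K n.+1) k : (0 < k <= n)%N ->
  rcoord (kmap (dual_hom (coface j)) u) k =
  (if (k <= j)%N then rcoord u k else 0) + (if (j <= k)%N then rcoord u k.+1 else 0).
Proof.
move=> kn; have kn2 : (k < n.+2)%N by lia.
have ko : (inord k : interval n) \notin fp_sub (interval n) by rewrite fp_outP inordK.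
rewrite {1}/rcoord insubT /= ffunE /=.
under eq_bigl => x do rewrite -val_eqE /= dual_coface inordK //.
rewrite (sum_fp_out (fun i => (if (i <= j)%N then i else i.-1) == k) u (f := id)) //.
have kn3 : (k < n.+3)%N by lia.
have kn3' : (k.+1 < n.+3)%N by lia.
rewrite big_mkcond (bigD1 (Ordinal kn3)) //= (bigD1 (Ordinal kn3')) /=; last first.
  by rewrite -val_eqE /=; lia.
rewrite big1 ?addr0 => [|i /andP[]].
  congr (_ + _).
    by case: (leqP k j) => kj; rewrite ?eqxx //; case: eqP => //; lia.
  by case: (leqP j k) => kj; case: (leqP k.+1 j) => kj'; case: eqP => //; lia.
rewrite -!val_eqE /= => /eqP ? /eqP ?.
by case: (leqP i j) => ij; case: eqP => //; lia.
Qed.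

(** Entry [n.+1], the last real one, is adjacent to the circle entry, and only
    the last face merges these two. *)
Lemma qcoord_face n (j : 'I_n.+2) (u : K n.+1) :
  qcoord (kmap (dual_hom (coface j)) u) =
  (if j == ord_max then \pi_RL (rcoord u n.+1) else 0) + qcoord u.
Proof.
rewrite /qcoord ffunE; congr (_ + _); last first.
  rewrite (big_pred1 (itop n.+1)) // => x; rewrite (fp_in_top x) /= eqxx.
  by apply/eqP; rewrite dual_fun_max.
under eq_bigl => x do rewrite -val_eqE /= dual_coface.
rewrite (sum_fp_out (fun i => (if (i <= j)%N then i else i.-1) == n.+1) u (f := \pi_RL)) ?raddf0 //.
have jn := ltn_ord j.
have n3 : (n.+1 < n.+3)%N by lia.
rewrite big_mkcond (bigD1 (Ordinal n3)) //= big1 ?addr0 => [|i].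
  rewrite -val_eqE /= leq_eqVlt ltnNge -ltnS jn orbF [_ == nat_of_ord j]eq_sym.
  by case: (nat_of_ord j == n.+1); rewrite ?eqxx // ltn_eqF.
rewrite -val_eqE /= => /eqP ne; case: ifP => // H.
rewrite rcoord_out ?raddf0 //; have := ltn_ord i.
by case: (leqP i j) H => ij /eqP ?; lia.
Qed.

Section Simplex1.
Variables (n : nat) (t : R) (q : RL).
Hypothesis t_le : `|t| <= lam.

Definition first_coord : {ffun fp_out (interval n.+1) -> R} :=
  [ffun x => if val x == inord 1 then t else 0].

Lemma first_coord_bound : \sum_x `|first_coord x| <= lam.
Proof.
have o1 : (inord 1 : interval n.+1) \notin fp_sub (interval n.+1).
  by rewrite fp_outP inordK.
rewrite (bigD1 (Sub (inord 1) o1)) //= big1 => [|x].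
  by rewrite addr0 ffunE eqxx.
by rewrite -val_eqE ffunE /= => /negPf ->; rewrite normr0.
Qed.

(** Homotopies in degrees 0 and 1 can be taken of this shape,
    [(t, 0, ..., 0, q)]. *)
Definition ksingle : K n.+1 := KElt [ffun=> q] first_coord_bound.

Lemma rcoord_ksingle k : (0 < k <= n.+1)%N ->
  rcoord ksingle k = if k == 1%N then t else 0.
Proof.
move=> kn; have kn2 : (k < n.+3)%N by lia.
rewrite /rcoord insubT /= ?fp_outP ?inordK // => H.
by rewrite ffunE /= -val_eqE /= !inordK.
Qed.

Lemma qcoord_ksingle : qcoord ksingle = q.
Proof. by rewrite /qcoord ffunE. Qed.

End Simplex1.
End Coordinates.

(** * Packing points on a circle *)

Section Circle.
Variables (R : realType) (L : zmodClosed R) (c lam : R).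
Hypotheses (c_gt0 : 0 < c) (lam_ge0 : 0 <= lam).
Hypothesis LP : forall x, reflect (exists m : int, x = m%:~R * c) (x \in L).

Local Notation RL := (Quotient.quot L).

Definition near_zero (q : RL) := exists2 t : R, `|t| <= lam & q = \pi_RL t.

Lemma pi_eqP (x y : R) : \pi_RL x = \pi_RL y <-> exists m : int, x = y + m%:~R * c.
Proof.
split=> [/eqP|[m E]].
  rewrite -Quotient.idealrBE => /LP[m E]; exists m; by rewrite -E addrC subrK.
by apply/eqP; rewrite -Quotient.idealrBE; apply/LP; exists m; rewrite E addrC addKr.
Qed.

Lemma reprP (q : RL) : exists2 t : R, 0 <= t < c & q = \pi_RL t.
Proof.
have := reprK q; move: (repr q) => x <-.
pose m := Num.floor (x / c).
exists (x - m%:~R * c); last by apply/pi_eqP; exists m; rewrite subrK.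
have /andP[] := floor_itv (x / c); rewrite -/m ler_pdivlMr // ltr_pdivrMr //.
by rewrite intrD mulrDl mul1r => h1 h2; apply/andP; split; lra.
Qed.

(** A representative [0 <= t < c] that is greater than [lam] can be replaced
    by [t - c]. *)
Lemma near_zero_all (q : RL) : c <= 2 * lam -> near_zero q.
Proof.
move=> cl; have [t /andP[t0 tc] ->] := reprP q.
have [tl|lt] := lerP t lam; first by exists t; rewrite // ger0_norm.
exists (t - c); last by apply/pi_eqP; exists 1; rewrite mul1r subrK.
by rewrite ltr0_norm ?subr_lt0 //; lra.
Qed.

(* The points are taken in a type [E] over [R / L], in order that the results
   apply to 0-simplices without first identifying these with points of [R / L]. *)
Variables (E : Type) (r : E -> E -> Prop) (q : E -> RL) (s : RL -> E).
Hypotheses (sK : cancel s q) (rE : forall x y, r x y <-> near_zero (q y - q x)).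

(** The witnesses are [n] equally spaced points: the difference of two of them
    is a multiple of [c / n], nonzero modulo [c], hence of absolute value at
    least [c / n > lam]. *)
Lemma unrelated_packing (n : nat) : n%:R * lam < c ->
  exists2 F : set E, unrelated r F & (F #= `I_n)%card.
Proof.
move=> nlc; have [->|n0] := posnP n.
  by exists set0 => //; rewrite II0.
have n0R : 0 < n%:R :> R by rewrite ltr0n.
pose pt (k : nat) : E := s (\pi_RL (k%:R / n%:R * c)).
have far i j : (i < n)%N -> (j < n)%N -> i <> j -> ~ r (pt i) (pt j).
  move=> iln jn ij /rE[t tl]; rewrite /pt !sK -raddfB /= => /pi_eqP[m Em].
  (* Multiplying by [n] makes the difference an integral multiple of [c]. *)
  have Et : n%:R * t = (j%:Z - i%:Z - m * n%:Z)%:~R * c.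
    have -> : t = (j%:R / n%:R - i%:R / n%:R - m%:~R) * c by lra.
    rewrite !(intrB, intrM) /= -!pmulrn; field.
    by rewrite gt_eqF.
  have : c <= n%:R * lam; last by lra.
  have : n%:R * `|t| <= n%:R * lam by rewrite ler_pM2l.
  rewrite -{1}(ger0_norm (ltW n0R)) -normrM Et normrM (gtr0_norm c_gt0).
  apply: le_trans; rewrite ler_peMl ?(ltW c_gt0) //.
  rewrite -intr_norm -[1]/(1%:~R) ler_int.
  suff : j%:Z - i%:Z - m * n%:Z != 0 by lia.
  apply/eqP => e0; have [m0|m0] := eqVneq m 0; first by rewrite m0 in e0; lia.
  have : (n%:Z <= `|m| * n%:Z)%R by rewrite ler_peMl //; lia.
  have -> : `|m| * n%:Z = `|j%:Z - i%:Z| by rewrite -[n%:Z in LHS]ger0_norm // -normrM; congr `|_|; lia.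
  by lia.
exists [set pt k | k in `I_n].
  by move=> _ _ [i /= iln <-] [j /= jn <-] ne; apply: far => // ij; apply: ne; rewrite ij.
apply: inj_card_eq => i j; rewrite !inE /= => iln jn eqij.
apply: contrapT => ij; apply: (far i j iln jn ij); apply/rE.
exists 0; first by rewrite normr0.
by rewrite eqij subrr raddf0.
Qed.

(** Measured from a point [x0] of [F], every other point [x] of [F] has a
    position [0 <= t x < c], and even [t x < c - lam <= n * lam] since [x] and
    [x0] are unrelated.  The index of the arc of length [lam] that contains
    [x] is thus less than [n], and it determines [x], as two points in the same arc
    are related. *)
Lemma unrelated_card_le (n : nat) (F : set E) :
  0 < lam -> lam < c -> c <= n.+1%:R * lam -> unrelated r F -> (F #<= `I_n)%card.
Proof.
move=> lam0 lc cn uF.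
have [->|/set0P[x0 Fx0]] := eqVneq F set0; first exact: card_ge0.
pose t x := xget 0 [set t : R | 0 <= t < c /\ q x - q x0 = \pi_RL t].
have tP x : 0 <= t x < c /\ q x - q x0 = \pi_RL (t x).
  rewrite /t; case: xgetP => [y _ //|no].
  by have [u u1 u2] := reprP (q x - q x0); case: (no u).
pose g x := Num.truncn (t x / lam).
have gP x : (g x)%:R * lam <= t x < (g x).+1%:R * lam.
  have [/andP[t0 _] _] := tP x.
  by rewrite -ler_pdivlMr // -ltr_pdivrMr // truncn_itv // divr_ge0 // ltW.
have ginj : {in F &, injective g}.
  move=> x y; rewrite !inE => Fx Fy gxy; apply: contrapT => xy.
  apply: (uF x y Fx Fy xy); apply/rE; exists (t y - t x).
    have := gP x; have := gP y; rewrite gxy -natr1 mulrDl mul1r.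
    by move=> /andP[? ?] /andP[? ?]; rewrite ler_norml; apply/andP; split; lra.
  rewrite raddfB /= -(tP x).2 -(tP y).2.
  by rewrite opprB addrA subrK.
have gn x : F x -> (g x < n)%N.
  move=> Fx; rewrite -(ltr_nat R) -(ltr_pM2r lam0).
  have [/andP[t0 tc] tE] := tP x; have /andP[gx _] := gP x.
  apply: le_lt_trans gx _; move: cn; rewrite -natr1 mulrDl mul1r => cn.
  have [xx0|xx0] := pselect (x = x0).
    have : \pi_RL (t x) = \pi_RL 0 by rewrite -tE xx0 subrr raddf0.
    move=> /pi_eqP[m]; rewrite add0r => Em.
    have m0 : m = 0.
      move: t0 tc; rewrite Em pmulr_lge0 // -[X in _ < X]mul1r ltr_pM2r //.
      by rewrite ler0z ltrz1; lia.
    by rewrite Em m0 mul0r; lra.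
  have : ~ (c - t x <= lam); last by move/negP; rewrite -ltNge; lra.
  move=> ctl; apply: (uF x0 x Fx0 Fx (nesym xx0)); apply/rE; exists (t x - c).
    by rewrite distrC ger0_norm //; lra.
  by rewrite tE; apply/pi_eqP; exists 1; rewrite mul1r subrK.
rewrite -(card_le_eql (inj_card_eq ginj)).
by apply: subset_card_le => _ [x Fx <-]; exact: gn.
Qed.

End Circle.

(** * The homotopy of [HD D] *)

Section HomotopyHD.
Variables (R : realType) (D : arakelovDivisor R).

Local Notation L := (adiv_lattice D).
Local Notation lam := (expR (adiv_inf D)).
Local Notation RL := (Quotient.quot L).

(** A face of [HD D] is an instance of [kmap] by conversion only, which
    rewriting does not see: hence this restatement and the next one. *)
Lemma rcoord_hface n (j : 'I_n.+2) (z : HD D n.+1) k : (0 < k <= n)%N ->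
  rcoord (face j z) k =
  (if (k <= j)%N then rcoord z k else 0) + (if (j <= k)%N then rcoord z k.+1 else 0).
Proof. exact: rcoord_face. Qed.

Lemma qcoord_hface n (j : 'I_n.+2) (z : HD D n.+1) :
  qcoord (face j z) =
  (if j == ord_max then \pi_RL (rcoord z n.+1) else 0) + qcoord z.
Proof. exact: qcoord_face. Qed.

Lemma rcoord_base n k : rcoord (sbase (HD D) n) k = 0.
Proof. by rewrite /rcoord /=; case: insubP => // x _ _; rewrite ffunE. Qed.

Lemma qcoord_base n : qcoord (sbase (HD D) n) = 0.
Proof. by rewrite /qcoord /= ffunE. Qed.

Lemma pi_set_inj n (x y : pi_set (HD D) n) : sval x = sval y -> x = y.
Proof.
case: x y => [x xs] [y ys] /= E; rewrite -{}E in ys *.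
by congr exist; exact: Prop_irrelevance.
Qed.

(** The faces of the 1-simplex [(t, q)] are [q] and [\pi t + q]. *)
Lemma htpy0E (x y : pi_set (HD D) 0) :
  htpy x y <-> near_zero lam (qcoord (sval y) - qcoord (sval x)).
Proof.
have nmax : (inord 0 == ord_max :> 'I_2) = false by rewrite -val_eqE /= inordK.
split=> [[z [_ zx zy]]|[t tl E]].
  exists (rcoord z 1); first exact: rcoord_le.
  by rewrite -zx -zy !qcoord_hface eqxx nmax add0r addrK.
exists (ksingle 0 (qcoord (sval x)) tl : HD D 1%N); split=> //.
  apply: K_eqP => [k|]; first by lia.
  by rewrite qcoord_hface nmax add0r qcoord_ksingle.
apply: K_eqP => [k|]; first by lia.
by rewrite qcoord_hface eqxx rcoord_ksingle // qcoord_ksingle -E subrK.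
Qed.

Lemma spherical1P (x : HD D 1%N) :
  spherical x <-> qcoord x = 0 /\ rcoord x 1 \in L.
Proof.
have piL t : (t \in L) = (\pi_RL t == 0).
  by rewrite -[t in LHS]subr0 Quotient.idealrBE raddf0.
split=> [sx|[q0 xL] j].
  have := congr1 (@qcoord _ _ _ _) (sx ord_max); have := congr1 (@qcoord _ _ _ _) (sx ord0).
  rewrite !qcoord_hface qcoord_base eqxx add0r => -> /eqP.
  by rewrite addr0 piL.
apply: K_eqP => [k|]; first by lia.
rewrite qcoord_hface qcoord_base q0 addr0; case: ifP => // _.
by apply/eqP; rewrite -piL.
Qed.

(** A homotopy [(z_1, z_2, z_3)] has 0-th face [(z_2, z_3)], which vanishes, so
    that its two other faces both have [z_1] as real entry. *)
Lemma htpy1E (x y : pi_set (HD D) 1) : htpy x y <-> x = y.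
Proof.
have [[x0 _] [y0 _]] := ((spherical1P (sval x)).1 (svalP x), (spherical1P (sval y)).1 (svalP y)).
split=> [[z [zb zx zy]]|<-].
  apply: pi_set_inj; apply: K_eqP => [k kn|]; last by rewrite x0 y0.
  have {kn} -> : k = 1%N by lia.
  have := congr1 (fun u => rcoord u 1) (zb ord0 isT).
  rewrite rcoord_base rcoord_hface //= add0r => z2.
  by rewrite -zx -zy !rcoord_hface //= inordK // z2 addr0.
exists (ksingle 1 0 (rcoord_le (sval x) 1) : HD D 2%N).
have face_x (j : 'I_3) : (0 < j)%N ->
    face j (ksingle 1 0 (rcoord_le (sval x) 1) : HD D 2%N) = sval x.
  move=> j0; apply: K_eqP => [k kn|].
    have {kn} -> : k = 1%N by lia.
    by rewrite rcoord_hface // j0 !rcoord_ksingle //= if_same addr0.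
  by rewrite qcoord_hface qcoord_ksingle rcoord_ksingle //= raddf0 if_same addr0 x0.
split; [move=> j j0|by rewrite face_x ?inordK|by rewrite face_x].
apply: K_eqP => [k kn|].
  have {kn} -> : k = 1%N by lia.
  rewrite rcoord_base rcoord_hface // !rcoord_ksingle //= leqNgt.
  by rewrite (leq_trans j0) // add0r if_same.
rewrite qcoord_base qcoord_hface qcoord_ksingle rcoord_ksingle //= raddf0.
by rewrite if_same addr0.
Qed.

(** Degree at least 2 is what makes [psi_1 + psi_2] a real number, so that its
    vanishing is stronger than a congruence modulo [L]. *)
Lemma spherical_base n (x : HD D n.+2) : spherical x -> x = sbase (HD D) n.+2.
Proof.
move=> sx; have x_high k : (0 < k <= n.+1)%N -> rcoord x k.+1 = 0.
  move=> kn; have := congr1 (fun u => rcoord u k) (sx ord0).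
  rewrite rcoord_base rcoord_hface //= leqNgt.
  by have /andP[-> _] := kn; rewrite add0r.
apply: K_eqP => [k kn|]; last first.
  by have := congr1 (@qcoord _ _ _ _) (sx ord0); rewrite !qcoord_base qcoord_hface add0r.
rewrite rcoord_base; have [k1|k1] := leqP k 1; last first.
  by case: k kn k1 => // k kn k1; apply: x_high; lia.
have {k1 kn} -> : k = 1%N by lia.
have := congr1 (fun u => rcoord u 1) (sx (inord 1)).
by rewrite rcoord_base rcoord_hface //= inordK //= (x_high 1%N) // addr0.
Qed.

Lemma pi_trivial_high n : pi_trivial (HD D) n.+2.
Proof.
move=> x y; exists (sbase (HD D) n.+3).
rewrite (spherical_base (svalP x)) (spherical_base (svalP y)).
by split=> [j _||]; exact: sact_base.
Qed.

Lemma HD_psi1E (x : HD D 1%N) : HD_psi1 x = rcoord x 1.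
Proof. by rewrite /HD_psi1 rcoordE /= inordK. Qed.

Lemma pi1_bij :
  RelationClasses.Equivalence (@htpy (HD D) 1) /\
  exists2 f : set (pi_set (HD D) 1) -> R,
    (forall x : pi_set (HD D) 1, f [set y | htpy x y] = HD_psi1 (sval x)) &
    set_bij (quotient_set (@htpy (HD D) 1)) (adiv_H0 D) f.
Proof.
split.
  split=> [x|x y /htpy1E|x y z /htpy1E -> //]; first exact/htpy1E.
  by move=> ->; apply/htpy1E.
have classE (x : pi_set (HD D) 1) : [set y | htpy x y] = [set x].
  by apply/seteqP; split=> y /=; rewrite htpy1E.
(* [A] is a singleton when it is a class: [f] picks the only value of
   [HD_psi1] on it. *)
pose f (A : set (pi_set (HD D) 1)) : R := xget 0 [set HD_psi1 (sval x) | x in A].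
have fE x : f [set y | htpy x y] = HD_psi1 (sval x).
  by rewrite classE /f image_set1; exact: xget_unique.
exists f => //; split.
- move=> _ [x _ <-]; rewrite fE HD_psi1E; split; last exact: rcoord_le.
  by have [] := (spherical1P (sval x)).1 (svalP x).
- move=> A B /set_mem[x _ <-] /set_mem[y _ <-]; rewrite !fE !HD_psi1E => xy.
  suff -> : x = y by [].
  apply: pi_set_inj; apply: K_eqP => [k kn|].
    by have -> : k = 1%N by lia.
  have [[-> _] [-> _]] := ((spherical1P (sval x)).1 (svalP x), (spherical1P (sval y)).1 (svalP y)).
  by [].
- move=> t [tL tl]; pose u : HD D 1%N := ksingle 0 (0 : RL) tl.
  have u1 : rcoord u 1 = t by rewrite rcoord_ksingle.
  have su : spherical u by apply/spherical1P; rewrite qcoord_ksingle u1.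
  pose U : pi_set (HD D) 1 := exist _ u su.
  exists [set y | htpy U y]; first by exists U.
  by rewrite fE HD_psi1E.
Qed.

Lemma period_ratio : expR (- adiv_deg D) * lam = period D.
Proof. by rewrite -expRD addrC. Qed.

Lemma pi0_point (q : RL) : {x : pi_set (HD D) 0 | qcoord (sval x) = q}.
Proof.
have b0 : \sum_(x : fp_out (interval 0)) `|([ffun=> 0] : {ffun fp_out (interval 0) -> R}) x| <= lam.
  by apply: kbase_bound; exact: expR_ge0.
pose u : HD D 0%N := KElt [ffun=> q] b0.
by exists (exist _ u I); rewrite /qcoord ffunE.
Qed.

Lemma pi0_trivial : - ln 2 <= adiv_deg D -> pi_trivial (HD D) 0.
Proof.
move=> dege x y; apply/htpy0E.
apply: (near_zero_all (expR_gt0 _) (@latticeP _ D)).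
rewrite -/(period D) -period_ratio ler_pM2r ?expR_gt0 //.
by rewrite -[leRHS]lnK ?posrE // ler_expR lerNl.
Qed.

Lemma card_pi0 (n : nat) : adiv_deg D < 0 ->
  n%:R < expR (- adiv_deg D) -> expR (- adiv_deg D) <= n.+1%:R ->
  nb_classes (@htpy (HD D) 0) n.
Proof.
move=> deg0 nlt len; have lam0 := expR_gt0 (adiv_inf D).
have c0 : 0 < period D := expR_gt0 _.
split.
  apply: (unrelated_packing c0 (ltW lam0) (@latticeP _ D)
            (q := fun x : pi_set (HD D) 0 => qcoord (sval x)) (s := fun q => sval (pi0_point q))).
  - by move=> q; exact: svalP (pi0_point q).
  - exact: htpy0E.
  - by rewrite -period_ratio ltr_pM2r.
move=> F; apply: (unrelated_card_le c0 (ltW lam0) (@latticeP _ D)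
            (q := fun x : pi_set (HD D) 0 => qcoord (sval x)) htpy0E lam0).
  by rewrite -period_ratio -[ltLHS]mul1r ltr_pM2r // -expR0 ltr_expR oppr_gt0.
by rewrite -period_ratio ler_pM2r.
Qed.

End HomotopyHD.

Unset Implicit Arguments.

Theorem proposition4p11 (R : realType) (D : arakelovDivisor R) :
  [/\ (- ln 2 <= adiv_deg D -> pi_trivial (HD D) 0),
      (adiv_deg D < 0 ->
        exists n : nat,
          [/\ n%:R < expR (- adiv_deg D),
              (forall m : int, m%:~R < expR (- adiv_deg D) -> m <= n%:Z) &
              nb_classes (@htpy (HD D) 0) n]),
      (RelationClasses.Equivalence (@htpy (HD D) 1) /\
        exists2 f : set (pi_set (HD D) 1) -> R,
          (forall x : pi_set (HD D) 1,
             f [set y | htpy x y] = HD_psi1 (sval x)) &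
          set_bij (quotient_set (@htpy (HD D) 1)) (adiv_H0 D) f) &
      (forall n : nat, (1 < n)%N -> pi_trivial (HD D) n)].
Proof.
split; [exact: pi0_trivial|move=> deg0|exact: pi1_bij|]; last first.
  by case=> [|[|n]] // _; exact: pi_trivial_high.
set e := expR _; have e0 : 0 < e := expR_gt0 _.
pose k := Num.ceil e; have /andP[kl ke] := ceil_itv e.
have k0 : 0 < k by rewrite -(ltr0z R); exact: lt_le_trans e0 ke.
(* The largest integer strictly below [e] is [ceil e - 1], also when [e] is an
   integer. *)
exists `|k - 1|%N.
have kn : (`|k - 1|%N)%:R = (k - 1)%:~R :> R by rewrite pmulrn; congr _%:~R; lia.
have kn1 : (`|k - 1|%N.+1)%:R = k%:~R :> R by rewrite pmulrn; congr _%:~R; lia.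
split; first by rewrite kn.
  move=> m me; suff : m < k by lia.
  by rewrite -(ltr_int R); exact: lt_le_trans me ke.
by apply: card_pi0; rewrite ?kn ?kn1.
Qed.
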